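(* Let $A$ be a Banach algebra, let $a,b\in A$, and suppose that $\sigma(a)$ is finite. Then $d(a,b)=0$ if and only if there exists $c\in A$, commuting with both $a$ and $b$, such that $a-c$ and $b-c$ are both quasinilpotent. In particular, if $A$ is semisimple and $a,b\in\mathrm{Soc}(A)$, then $d(a,b)=0$ if and only if there exists $c\in\mathrm{Soc}(A)$, commuting with both $a$ and $b$, such that $a-c$ and $b-c$ are both nilpotent.
   Context: Banach algebras are over $\mathbb{C}$ and have a unit $1$; $\sigma(x)$ is the spectrum of $x\in A$, and $x$ is quasinilpotent if $\sigma(x)=\{0\}$. For $a,b\in A$ let $C_{a,b}:A\to A$ be the bounded operator $C_{a,b}x=ax-xb$, put $\rho(a,b)=\limsup_{n\to\infty}\|C_{a,b}^n1\|^{1/n}$ and $d(a,b)=\max\{\rho(a,b),\rho(b,a)\}$. For $A$ semisimple, $\mathrm{Soc}(A)$ (the socle) is the two-sided ideal of all finite sums of rank one elements, where $0\neq u\in A$ is rank one if $uAu\subseteq\mathbb{C}u$ (the zero element is included as the empty sum); every element of $\mathrm{Soc}(A)$ has finite spectrum. *)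

(* Defs.v *)
From HB Require Import structures.
From mathcomp Require Import all_boot all_order all_algebra.
From mathcomp Require Import all_classical all_reals all_analysis.
From mathcomp Require Export complex.

Set Implicit Arguments.
Unset Strict Implicit.
Unset Printing Implicit Defensive.

Import Order.TTheory GRing.Theory Num.Theory.
Import numFieldNormedType.Exports.

Local Open Scope classical_set_scope.
Local Open Scope ring_scope.
Local Open Scope complex_scope.

(* The product is a field of the mixin, and [GRing.Algebra] is derived below,
   because HB refuses a structure that joins the ring and the normed hierarchies
   above [Num.NumDomain]. [ba_oner_neq0] makes the algebra nonzero, so that
   spectra are nonempty; [`|1| = 1] is not required. *)
HB.mixin Record CompleteNormedModule_isBanachAlgebra (K : numFieldType) A
    of CompleteNormedModule K A := {
  ba_one : A;
  ba_mul : A -> A -> A;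
  ba_mulA : associative ba_mul;
  ba_mul1r : left_id ba_one ba_mul;
  ba_mulr1 : right_id ba_one ba_mul;
  ba_mulDl : left_distributive ba_mul +%R;
  ba_mulDr : right_distributive ba_mul +%R;
  ba_oner_neq0 : ba_one != 0;
  ba_scalerAl : forall (k : K) (x y : A), k *: ba_mul x y = ba_mul (k *: x) y;
  ba_scalerAr : forall (k : K) (x y : A), k *: ba_mul x y = ba_mul x (k *: y);
  ba_ler_normM : forall x y : A, `|ba_mul x y| <= `|x| * `|y|
}.

#[short(type="banachAlgType")]
HB.structure Definition BanachAlgebra (K : numFieldType) :=
  {A of CompleteNormedModule K A & CompleteNormedModule_isBanachAlgebra K A}.

Section BanachAlgebraIsAlgebra.
Context {K : numFieldType} (A : banachAlgType K).

#[non_forgetful_inheritance]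
HB.instance Definition _ := GRing.Zmodule_isNzRing.Build A
  ba_mulA ba_mul1r ba_mulr1 ba_mulDl ba_mulDr ba_oner_neq0.

#[non_forgetful_inheritance]
HB.instance Definition _ := GRing.Lmodule_isLalgebra.Build K A ba_scalerAl.

#[non_forgetful_inheritance]
HB.instance Definition _ := GRing.Lalgebra_isAlgebra.Build K A ba_scalerAr.

Lemma ler_normM (x y : A) : `|x * y| <= `|x| * `|y|.
Proof. exact: ba_ler_normM. Qed.

End BanachAlgebraIsAlgebra.

Section AlgebraicNotions.
Context {R : realType} {A : algType R[i]}.
Implicit Types (a b u x : A) (I : set A).

Definition invertible x : Prop := exists y, x * y = 1 /\ y * x = 1.

Definition spectrum x : set R[i] := [set z | ~ invertible (x - z%:A)].

Definition quasinilpotent x : Prop := spectrum x = [set 0].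

Definition nilpotent x : Prop := exists n, x ^+ n = 0.

Definition left_ideal I : Prop :=
  [/\ I 0, (forall x y, I x -> I y -> I (x + y))
     & (forall x y, I y -> I (x * y))].

Definition maximal_left_ideal I : Prop :=
  [/\ left_ideal I, I <> setT
    & forall J, left_ideal J -> I `<=` J -> J = I \/ J = setT].

Definition jacobson_radical : set A := \bigcap_(I in maximal_left_ideal) I.

Definition rank_one u : Prop :=
  u <> 0 /\ forall x, exists z : R[i], u * x * u = z *: u.

Definition socle : set A :=
  [set x | exists s : seq A,
     (forall u, u \in s -> rank_one u) /\ x = \sum_(u <- s) u].

Definition commutator_op a b x : A := a * x - x * b.

End AlgebraicNotions.

Definition semisimple {R : realType} (A : algType R[i]) : Prop :=
  @jacobson_radical R A = [set 0].

(* The norm is valued in [R[i]]; it is real and nonnegative, so [complex.Re]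
   loses nothing. *)
Definition rho {R : realType} {A : banachAlgType R[i]} (a b : A) : \bar R :=
  limn_esup (fun n : nat =>
    (complex.Re `|iter n (commutator_op a b) 1| `^ n%:R^-1)%:E).

Definition dist_spec {R : realType} {A : banachAlgType R[i]} (a b : A)
  : \bar R := maxe (rho a b) (rho b a).

(* Main.v *)
From HB Require Import structures.
Require Import Defs.
From mathcomp Require Import all_boot all_order all_algebra.
From mathcomp Require Import all_classical all_reals all_analysis.
From mathcomp Require Import ring lra.

(** The condition [d(a, b) = 0] says that the iterated generalized commutators
    [C_{a,b}^n 1] and [C_{b,a}^n 1] decay superexponentially. Decay is preserved
    by binomial convolution, and the Leibniz rule
    [C_{a,c}^n (xy) = \sum_i 'C(n, i) C_{a,b}^(n-i) x * C_{b,c}^i y] with an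
    arbitrary middle element [b] ([commutator_leibniz]) makes the condition
    transitive ([rho_null_trans]). If [a] and [c] commute, then
    [C_{a,c}^n 1 = (a - c)^n], and the decay of these powers means that [a - c]
    is quasinilpotent ([quasinilpotentP]). Thus a common [c] as in the theorem
    gives [d(a, c) = d(c, b) = 0], whence [d(a, b) = 0].

    Conversely, if the spectrum of [a] is finite, [a] has a diagonal part
    ([diagonal_part]): an element [c] of its bicommutant with [a - c]
    quasinilpotent and [c] a linear combination of commuting idempotents. The
    idempotents are lifts of the Lagrange polynomials evaluated at [a]
    ([idempotent_lift]). From [d(a, c) = 0] and [d(a, b) = 0] follows
    [d(c, b) = 0], and the Leibniz rule for [b = 1 * b * 1] shows that
    [C_{c,c}^n b] decays superexponentially ([rho_null_inner]). But [C_{c,c}]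
    acts on the block [p b p'] between two spectral projections of [c] as
    multiplication by the difference of the eigenvalues, so all blocks with
    different eigenvalues vanish and [c] commutes with [b] ([diagonal_comm]).
    Then [C_{c,b}^n 1 = (c - b)^n], and [b - c] is quasinilpotent.

    The spectral radius formula that links spectrum and decay is proved without
    complex integration, by averaging the resolvent over the roots of unity of
    order [2^m] ([power_resP]): the averages are equicontinuous in [m], which
    allows the region where [(s q)^(2^m)] tends to 0 to be enlarged by steps of
    fixed size.

    For the socle, adding a rank one element to an algebraic element gives an
    algebraic element ([algebraicD_rank_one]). So elements of the socle have
    finite spectrum, and they are nilpotent when they are quasinilpotent. The
    diagonal part of [a] lies in the socle together with [a], because its
    spectral projections for nonzero eigenvalues are multiples of [a]
    ([spectral_projection_multiple]). *)

Set Implicit Arguments.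
Unset Strict Implicit.
Unset Printing Implicit Defensive.

Import Order.TTheory GRing.Theory Num.Theory.
Import numFieldNormedType.Exports.

Local Open Scope classical_set_scope.
Local Open Scope ring_scope.
Local Open Scope complex_scope.

(** * The norm as a real number *)

Section RealModulus.
Context {R : realType}.
Implicit Types k z : R[i].

(** Norms take their values in [R[i]]; estimates are carried out in the ordered
    field [R], on the real parts. *)
Definition cabs k : R := complex.Re `|k|.

Lemma cabsE k : `|k| = (cabs k)%:C.
Proof. by rewrite /cabs RRe_real // normr_real. Qed.

Lemma cabs_ge0 k : 0 <= cabs k.
Proof. by rewrite -ler0c -cabsE normr_ge0. Qed.

Lemma cabs_gt0 k : (0 < cabs k) = (k != 0).
Proof. by rewrite -ltcR -cabsE normr_gt0. Qed.

Lemma cabsM k z : cabs (k * z) = cabs k * cabs z.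
Proof. by apply: complexI; rewrite rmorphM /= -!cabsE normrM. Qed.

Lemma cabsX k n : cabs (k ^+ n) = cabs k ^+ n.
Proof. by apply: complexI; rewrite rmorphXn /= -!cabsE normrX. Qed.

Lemma cabs_real (r : R) : 0 <= r -> cabs r%:C = r.
Proof. by move=> r0; apply: complexI; rewrite -cabsE ger0_norm // ler0c. Qed.

Lemma cabs_sqrt k : cabs k = Num.sqrt (complex.Re k ^+ 2 + complex.Im k ^+ 2).
Proof. by apply: complexI; rewrite -cabsE normc_def. Qed.

Lemma ler_cabs_Re k : `|complex.Re k| <= cabs k.
Proof. by rewrite cabs_sqrt -sqrtr_sqr ler_wsqrtr // lerDl sqr_ge0. Qed.

Lemma ler_cabs_Im k : `|complex.Im k| <= cabs k.
Proof. by rewrite cabs_sqrt -sqrtr_sqr ler_wsqrtr // lerDr sqr_ge0. Qed.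

Lemma cabs_le_ReIm k : cabs k <= `|complex.Re k| + `|complex.Im k|.
Proof.
rewrite cabs_sqrt -[leRHS]ger0_norm ?addr_ge0 // -sqrtr_sqr ler_wsqrtr //.
rewrite sqrrD !real_normK ?num_real // lerD2r lerDl mulrn_wge0 //.
Qed.

End RealModulus.

Section RealNorm.
Context {R : realType} {A : banachAlgType R[i]}.
Implicit Types (x y : A) (k : R[i]).

Definition rnorm x : R := complex.Re `|x|.

Lemma rnormE x : `|x| = (rnorm x)%:C.
Proof. by rewrite /rnorm RRe_real // normr_real. Qed.

Lemma rnorm_ge0 x : 0 <= rnorm x.
Proof. by rewrite -lecR -rnormE normr_ge0. Qed.

Lemma rnorm0 : rnorm 0 = 0 :> R.
Proof. by rewrite /rnorm normr0. Qed.

Lemma rnorm_eq0 x : rnorm x = 0 -> x = 0.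
Proof. by move=> x0; apply/eqP; rewrite -normr_eq0 rnormE x0. Qed.

Lemma ler_rnormD x y : rnorm (x + y) <= rnorm x + rnorm y.
Proof. by rewrite -lecR rmorphD /= -!rnormE; exact: ler_normD. Qed.

Lemma rnormN x : rnorm (- x) = rnorm x.
Proof. by rewrite /rnorm normrN. Qed.

Lemma rnormBC x y : rnorm (x - y) = rnorm (y - x).
Proof. by rewrite /rnorm distrC. Qed.

Lemma ler_rnormB x y : rnorm (x - y) <= rnorm x + rnorm y.
Proof. by rewrite -(rnormN y) ler_rnormD. Qed.

Lemma ler_rnormM x y : rnorm (x * y) <= rnorm x * rnorm y.
Proof. by rewrite -lecR rmorphM /= -!rnormE; exact: ler_normM. Qed.

Lemma rnormZ k x : rnorm (k *: x) = cabs k * rnorm x.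
Proof.
by apply: complexI; rewrite rmorphM /= -rnormE -cabsE -rnormE normrZ.
Qed.

Lemma ler_rnormMn x n : rnorm (x *+ n) <= rnorm x *+ n.
Proof.
elim: n => [|n IHn]; first by rewrite !mulr0n rnorm0.
by rewrite !mulrS (le_trans (ler_rnormD _ _)) ?lerD2l.
Qed.

Lemma ler_rnorm_sum I (r : seq I) (P : pred I) (F : I -> A) :
  rnorm (\sum_(i <- r | P i) F i) <= \sum_(i <- r | P i) rnorm (F i).
Proof.
elim/big_ind2: _ => [|x1 r1 x2 r2 le1 le2|//]; first by rewrite rnorm0.
by rewrite (le_trans (ler_rnormD _ _)) ?lerD.
Qed.

Lemma ler_rnormX x n : rnorm (x ^+ n) <= rnorm 1 * rnorm x ^+ n.
Proof.
elim: n => [|n IHn]; first by rewrite !expr0 mulr1.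
rewrite !exprS (le_trans (ler_rnormM _ _)) // mulrCA.
by rewrite ler_wpM2l ?rnorm_ge0.
Qed.

Lemma rnorm_geometric_eq0 x (M : R) :
  (forall n, rnorm x <= M * 2^-1 ^+ n) -> x = 0.
Proof.
move=> xM; apply: rnorm_eq0; apply/eqP; rewrite eq_le rnorm_ge0 andbT leNgt.
apply/negP => x0.
have [n Mn] : exists n, M / rnorm x < n%:R.
  exists (Num.bound (M / rnorm x)); apply: archi_boundP.
  rewrite divr_ge0 ?rnorm_ge0 // -[M]mulr1 -(expr0 2^-1).
  by rewrite (le_trans _ (xM 0)) ?rnorm_ge0.
have := xM n; rewrite exprVn ler_pdivlMr ?exprn_gt0 // leNgt mulrC.
rewrite -ltr_pdivrMr // => /negP; apply.
by rewrite (lt_trans Mn) // -natrX ltr_nat ltn_expl.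
Qed.

Lemma rnorm1_gt0 : 0 < rnorm 1.
Proof.
rewrite lt_def rnorm_ge0 andbT; apply/eqP => /rnorm_eq0/eqP.
by rewrite oner_eq0.
Qed.

(** A sequence with geometrically decreasing steps is Cauchy; completeness is
    used only in this quantitative form. *)
Lemma geometric_cvg (u : nat -> A) (M : R) :
  (forall n, rnorm (u n.+1 - u n) <= M * 2^-1 ^+ n) ->
  exists l, forall n, rnorm (l - u n) <= 2 * M * 2^-1 ^+ n.
Proof.
move=> uM.
have M0 : 0 <= M by have := uM 0; rewrite expr0 mulr1; apply/le_trans/rnorm_ge0.
have uD n m : rnorm (u (n + m)%N - u n) <= 2 * M * 2^-1 ^+ n.
  suff: rnorm (u (n + m)%N - u n) <= 2 * M * 2^-1 ^+ n * (1 - 2^-1 ^+ m).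
    move=> /le_trans; apply; rewrite -[leRHS]mulr1 ler_wpM2l //.
    by rewrite !mulr_ge0 ?exprn_ge0 ?invr_ge0.
  elim: m => [|m IHm]; first by rewrite addn0 subrr rnorm0 expr0 subrr mulr0.
  rewrite addnS -(subrKA (u (n + m)%N)) (le_trans (ler_rnormD _ _)) //.
  have := uM (n + m)%N; rewrite exprD exprS; move: IHm.
  set a := _ ^+ n; set b := _ ^+ m; lra.
have half_cvg : (fun n => 2 * M * 2^-1 ^+ n) @ \oo --> (0 : R).
  rewrite -[X in _ --> X](mulr0 (2 * M)); apply: cvgMr; apply: cvg_expr.
  by rewrite ger0_norm ?invr_ge0 // invf_lt1 ?ltr1n.
have u_cvg : cvg (u @ \oo).
  apply/cauchy_cvgP; apply: cauchy_exP => e e0.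
  have e0' : 0 < complex.Re e by move: e0; rewrite ltcE => /andP[].
  have [N _ NP] := (cvgrPdist_lt _ _).1 half_cvg _ e0'.
  exists (u N); exists N => // n /= Nn.
  rewrite -ball_normE /= distrC rnormE.
  have -> : e = (complex.Re e)%:C.
    by rewrite RRe_real // gtr0_real.
  rewrite ltcR -(subnKC Nn) (le_lt_trans (uD N _)) //.
  have := NP N (leqnn N); rewrite sub0r normrN.
  exact: le_lt_trans (ler_norm _).
exists (lim (u @ \oo)) => n.
apply/ler_addgt0Pr => e e0.
have e0' : 0 < e%:C by rewrite ltcR.
have [N _ NP] := (cvgrPdist_lt _ _).1 u_cvg _ e0'.
have := NP (n + N)%N (leq_addl _ _); rewrite rnormE ltcR => /ltW leN.
rewrite -(subrKA (u (n + N)%N)) (le_trans (ler_rnormD _ _)) // addrC.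
by rewrite lerD.
Qed.

End RealNorm.

(** * Superexponential decay *)

Section FastDecay.
Context {R : realType} {A : banachAlgType R[i]}.
Implicit Types (x y : A) (u v : nat -> A).

(** This is [limsup |u n|^(1/n) = 0], in a form that suits products and
    sums. *)
Definition fast_decay u : Prop :=
  forall e : R, 0 < e -> exists M, forall n, rnorm (u n) <= M * e ^+ n.

(** The spectral radius formula identifies these elements with the
    quasinilpotent ones. *)
Definition top_nilpotent x : Prop := fast_decay (fun n => x ^+ n).

Lemma decay_const_ge0 u (M e : R) :
  (forall n, rnorm (u n) <= M * e ^+ n) -> 0 <= M.
Proof.
by move=> /(_ 0); rewrite expr0 mulr1; apply/le_trans/rnorm_ge0.
Qed.

Lemma eq_fast_decay u v : u =1 v -> fast_decay u -> fast_decay v.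
Proof.
by move=> uv fu e /fu [M uM]; exists M => n; rewrite -uv.
Qed.

(** The binomial weights add up to [2^n], which is absorbed by halving [e]. *)
Lemma ler_rnorm_binomial n (F : 'I_n.+1 -> A) (M e : R) :
  (forall i, rnorm (F i) <= M * (e / 2) ^+ n) ->
  rnorm (\sum_(i < n.+1) F i *+ 'C(n, i)) <= M * e ^+ n.
Proof.
move=> FM; rewrite (le_trans (ler_rnorm_sum _ _ _)) //.
have -> : M * e ^+ n = \sum_(i < n.+1) (M * (e / 2) ^+ n) *+ 'C(n, i).
  rewrite [in LHS](splitr e) exprDn mulr_sumr; apply: eq_bigr => i _.
  by rewrite -exprD subnK ?mulrnAr // -ltnS.
apply: ler_sum => i _; rewrite (le_trans (ler_rnormMn _ _)) // lerMn2r.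
by rewrite FM orbT.
Qed.

Lemma fast_decay_binomial u v : fast_decay u -> fast_decay v ->
  fast_decay (fun n => \sum_(i < n.+1) (u (n - i)%N * v i) *+ 'C(n, i)).
Proof.
move=> fu fv e e0; have e20 : 0 < e / 2 by rewrite divr_gt0.
have [M uM] := fu _ e20; have [N vN] := fv _ e20.
exists (M * N) => n; apply: ler_rnorm_binomial => i.
have -> : M * N * (e / 2) ^+ n = (M * (e / 2) ^+ (n - i)) * (N * (e / 2) ^+ i).
  by rewrite mulrACA -exprD subnK // -ltnS.
by rewrite (le_trans (ler_rnormM _ _)) // ler_pM ?rnorm_ge0.
Qed.

Lemma fast_decayMl x u : fast_decay u -> fast_decay (fun n => x * u n).
Proof.
move=> fu e /fu[M uM]; exists (rnorm x * M) => n.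
by rewrite (le_trans (ler_rnormM _ _)) // -mulrA ler_wpM2l ?rnorm_ge0.
Qed.

Lemma fast_decayMr x u : fast_decay u -> fast_decay (fun n => u n * x).
Proof.
move=> fu e /fu[M uM]; exists (M * rnorm x) => n.
by rewrite (le_trans (ler_rnormM _ _)) // mulrAC ler_wpM2r ?rnorm_ge0.
Qed.

(** Compare [|k|^n] with the decay at the rate [|k|/2]. *)
Lemma fast_decay_geometric (k : R[i]) x :
  k != 0 -> fast_decay (fun n => k ^+ n *: x) -> x = 0.
Proof.
move=> k0 fx; have k_gt0 : 0 < cabs k by rewrite cabs_gt0.
have [M xM] := fx (cabs k / 2) (divr_gt0 k_gt0 (ltr0n _ 2)).
apply: (@rnorm_geometric_eq0 _ _ _ M) => n; have := xM n.
by rewrite rnormZ cabsX exprMn mulrCA ler_pM2l ?exprn_gt0.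
Qed.

(** One power that is small enough controls all of them, by Euclidean
    division of the exponent. *)
Lemma top_nilpotentP x :
  (forall e : R, 0 < e -> exists2 N, (0 < N)%N & rnorm (x ^+ N) <= e ^+ N) ->
  top_nilpotent x.
Proof.
move=> xe e e0; have [N N0 xN] := xe e e0.
exists (rnorm (1 : A) * \sum_(r < N) rnorm (x ^+ r) / e ^+ r) => n.
rewrite [in rnorm (x ^+ n)](divn_eq n N) exprD mulnC exprM.
rewrite (le_trans (ler_rnormM _ _)) //.
have lt_r : (n %% N < N)%N by rewrite ltn_mod.
have le1 : rnorm ((x ^+ N) ^+ (n %/ N)) <= rnorm (1 : A) * e ^+ (N * (n %/ N)).
  rewrite (le_trans (ler_rnormX _ _)) // ler_wpM2l ?rnorm_ge0 // exprM.
  by rewrite lerXn2r // nnegrE ?rnorm_ge0 ?exprn_ge0 // ltW.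
have le2 : rnorm (x ^+ (n %% N)) <=
    (\sum_(r < N) rnorm (x ^+ r) / e ^+ r) * e ^+ (n %% N).
  rewrite -ler_pdivrMr ?exprn_gt0 // (bigD1 (Ordinal lt_r)) //= lerDl.
  by apply: sumr_ge0 => i _; rewrite divr_ge0 ?rnorm_ge0 ?exprn_ge0 // ltW.
rewrite (le_trans (ler_pM _ _ le1 le2)) ?rnorm_ge0 //.
rewrite {3}(divn_eq n N) mulnC exprD.
by rewrite mulrACA.
Qed.

Lemma top_nilpotentN x : top_nilpotent x -> top_nilpotent (- x).
Proof.
move=> fx e /fx[M xM]; exists M => n; rewrite exprNn.
by rewrite -signr_odd; case: odd; rewrite ?expr1 ?mulN1r ?rnormN ?mul1r.
Qed.

Lemma top_nilpotentD x y : GRing.comm x y ->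
  top_nilpotent x -> top_nilpotent y -> top_nilpotent (x + y).
Proof.
move=> cxy fx fy; apply: eq_fast_decay (fast_decay_binomial fx fy) => n.
by rewrite exprDn_comm.
Qed.

Lemma top_nilpotent0 : top_nilpotent 0.
Proof.
move=> e e0; exists (rnorm (1 : A)) => -[|n]; first by rewrite !expr0 mulr1.
by rewrite expr0n /= rnorm0 mulr_ge0 ?rnorm_ge0 ?exprn_ge0 // ltW.
Qed.

Lemma top_nilpotentM x y : GRing.comm x y ->
  top_nilpotent x -> top_nilpotent (x * y).
Proof.
move=> cxy fx; have [->|y0] := eqVneq y 0.
  by rewrite mulr0; exact: top_nilpotent0.
have ry0 : 0 < rnorm y.
  by rewrite lt_def rnorm_ge0 andbT; apply: contra_neq y0 => /rnorm_eq0.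
move=> e e0; have [M xM] := fx _ (divr_gt0 e0 ry0).
exists (M * rnorm (1 : A)) => n.
rewrite exprMn_comm // (le_trans (ler_rnormM _ _)) //.
rewrite (le_trans (ler_pM _ _ (xM n) (ler_rnormX y n))) ?rnorm_ge0 //.
by rewrite mulrACA -exprMn divfK // gt_eqF.
Qed.

Lemma top_nilpotentZ (k : R[i]) x : top_nilpotent x -> top_nilpotent (k *: x).
Proof.
by move=> fx; rewrite -mulr_algr; apply: top_nilpotentM => //;
  rewrite /GRing.comm mulr_algr mulr_algl.
Qed.

(** Expand [((x - y) + y)^n]: on commuting elements the spectral radius is
    subadditive, hence continuous. *)
Lemma top_nilpotent_closed x :
  (forall e : R, 0 < e -> exists y,
     [/\ GRing.comm x y, top_nilpotent y & rnorm (x - y) <= e]) ->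
  top_nilpotent x.
Proof.
move=> xe e e0; have e20 : 0 < e / 2 by rewrite divr_gt0.
have [y [cxy fy xy]] := xe _ e20; have [M yM] := fy _ e20.
exists (rnorm (1 : A) * M) => n.
rewrite -{1}(subrK y x) exprDn_comm; last first.
  by apply: commr_sym; apply: commrB => //; apply: commr_sym.
apply: ler_rnorm_binomial => i.
have -> : rnorm (1 : A) * M * (e / 2) ^+ n
    = (rnorm (1 : A) * (e / 2) ^+ (n - i)) * (M * (e / 2) ^+ i).
  by rewrite mulrACA -exprD subnK // -ltnS.
rewrite (le_trans (ler_rnormM _ _)) //.
rewrite ler_pM ?rnorm_ge0 // (le_trans (ler_rnormX _ _)) //.
by rewrite ler_wpM2l ?rnorm_ge0 // lerXn2r // nnegrE ?rnorm_ge0 // ltW.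
Qed.

End FastDecay.

(** * Iterated generalized commutators *)

Section Commutator.
Context {R : realType} {A : algType R[i]}.
Implicit Types (a b c x y : A).

Lemma commutator_op_is_zmod_morphism a b : zmod_morphism (commutator_op a b).
Proof.
move=> x y; rewrite /commutator_op mulrBr mulrBl !opprB -!addrA.
by congr (_ + _); rewrite addrCA [RHS]addrCA [X in _ + X]addrC.
Qed.

HB.instance Definition _ a b := GRing.isZmodMorphism.Build A A
  (commutator_op a b) (commutator_op_is_zmod_morphism a b).

(** If [D] acts on a doubly indexed family as the sum of the two shifts, then
    the shifts commute and the binomial formula gives its iterates. *)
Lemma iter_shift_binomial (D : {additive A -> A}) (F : nat -> nat -> A) n :
  (forall i j, D (F i j) = F i.+1 j + F i j.+1) ->
  iter n D (F 0 0) = \sum_(i < n.+1) F (n - i)%N i *+ 'C(n, i).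
Proof.
move=> DF; elim: n => [|n IHn]; first by rewrite big_ord1 bin0 mulr1n.
rewrite iterS IHn raddf_sum /=.
under eq_bigr do rewrite (raddfMn D) DF mulrnDl.
rewrite big_split /= big_ord_recl [X in _ + X]big_ord_recr /=.
rewrite [RHS]big_ord_recl big_ord_recr /= /bump !leq0n !add1n.
rewrite !subnn !subn0 !binn !bin0 !mulr1n -!addrA; congr (_ + _).
rewrite addrA -big_split /=; congr (_ + _).
apply: eq_bigr => i _; rewrite !add1n subSS -subSn ?(valP i) // subSS.
by rewrite binS mulrnDr.
Qed.

(** The splitting [a(xy) - (xy)c = (ax - xb)y + x(by - yc)] turns the iterates
    into a Leibniz rule, with an arbitrary intermediate element [b]. *)
Lemma commutator_leibniz a b c x y n :
  iter n (commutator_op a c) (x * y) =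
  \sum_(i < n.+1) (iter (n - i) (commutator_op a b) x *
                   iter i (commutator_op b c) y) *+ 'C(n, i).
Proof.
pose F i j := iter i (commutator_op a b) x * iter j (commutator_op b c) y.
rewrite -[x * y]/(F 0%N 0%N); apply: iter_shift_binomial => i j.
rewrite /F /= /commutator_op mulrBl mulrBr !mulrA.
by rewrite subrKA.
Qed.

Lemma iter_commutator_comm a b n :
  GRing.comm a b -> iter n (commutator_op a b) 1 = (a - b) ^+ n.
Proof.
move=> cab; elim: n => [//|n IHn]; rewrite iterS IHn exprS /commutator_op.
rewrite mulrBl; congr (_ - _); apply/esym/commrX/commrB.
  exact/commr_sym.
exact: commr_refl.
Qed.

End Commutator.

Section RhoNull.
Context {R : realType} {A : banachAlgType R[i]}.
Implicit Types (a b c x : A).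

(** By [rho_eq0] this is [rho a b = 0]. *)
Definition rho_null a b : Prop :=
  fast_decay (fun n => iter n (commutator_op a b) 1).

(** The Leibniz rule for [1 * 1]. *)
Lemma rho_null_trans b a c : rho_null a b -> rho_null b c -> rho_null a c.
Proof.
move=> ab bc; apply: eq_fast_decay (fast_decay_binomial ab bc) => n.
by rewrite -commutator_leibniz mulr1.
Qed.

Lemma rho_null_comm a b :
  GRing.comm a b -> rho_null a b <-> top_nilpotent (a - b).
Proof.
move=> cab; split; apply: eq_fast_decay => n; first exact: iter_commutator_comm.
by rewrite iter_commutator_comm.
Qed.

(** Write [b = 1 * (b * 1)] and pass through [b], whose commutator with itself
    vanishes. *)
Lemma rho_null_inner c b : rho_null c b -> rho_null b c ->
  fast_decay (fun n => iter n (commutator_op c c) b).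
Proof.
move=> cb bc.
have bbc : fast_decay (fun n => iter n (commutator_op b c) b).
  apply: eq_fast_decay (fast_decayMl b bc) => n.
  elim: n => [|n IHn]; first by rewrite mulr1.
  by rewrite !iterS -IHn /commutator_op mulrBr !mulrA.
apply: eq_fast_decay (fast_decay_binomial cb bbc) => n.
by rewrite -commutator_leibniz mul1r.
Qed.

(** A bound [M (e/2)^n] is below [e^n] as soon as [2^n >= M]; conversely, the
    finitely many terms that exceed [e^n] only enlarge the constant. *)
Lemma rho_eq0 a b : rho a b = 0%E <-> rho_null a b.
Proof.
rewrite /rho /rho_null; set u := fun n => iter n (commutator_op a b) 1.
rewrite -/(u _); pose r n : R := rnorm (u n) `^ n%:R^-1.
have rE n : (0 < n)%N -> r n ^+ n = rnorm (u n).
  move=> n0; rewrite -powR_mulrn ?powR_ge0 // -powRrM.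
  rewrite mulVf ?pnatr_eq0 -?lt0n //.
  by rewrite powRr1 // rnorm_ge0.
have r0 n : 0 <= r n by exact: powR_ge0.
suff : (fun n => (r n)%:E) @ \oo --> 0%E <-> fast_decay u.
  move=> <-; split=> [h|h]; first by apply: limn_esup_le_cvg; rewrite ?h.
  by rewrite is_cvg_limn_esupE; [exact: cvg_lim h | exact: cvgP h].
split=> [/fine_cvgP[_ r_cvg] e e0|fu].
  have [N _ NP] := (cvgrPdist_lt _ _).1 r_cvg _ e0.
  exists (1 + \sum_(k < N.+1) rnorm (u k) / e ^+ k) => n.
  have S0 : 0 <= \sum_(k < N.+1) rnorm (u k) / e ^+ k.
    by apply: sumr_ge0 => i _; rewrite divr_ge0 ?rnorm_ge0 ?exprn_ge0 // ltW.
  rewrite -ler_pdivrMr ?exprn_gt0 //; have [lt_nN|le_Nn] := ltnP n N.+1.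
    rewrite (bigD1 (Ordinal lt_nN)) //= addrCA lerDl addr_ge0 //.
    by apply: sumr_ge0 => i _; rewrite divr_ge0 ?rnorm_ge0 ?exprn_ge0 // ltW.
  rewrite (@le_trans _ _ 1) ?lerDl // ler_pdivrMr ?exprn_gt0 // mul1r -rE.
    rewrite lerXn2r ?nnegrE // ?(ltW e0) //.
    have := NP n (ltnW le_Nn); rewrite sub0r normrN /= ger0_norm //.
    by move/ltW.
  exact: leq_ltn_trans le_Nn.
apply/fine_cvgP; split; first by exists 0%N.
apply/cvgrPdist_le => e e0; have [M uM] := fu _ (divr_gt0 e0 (ltr0n _ 2)).
exists (Num.bound M).+1 => // n /= Mn.
have M0 := decay_const_ge0 uM.
rewrite sub0r normrN ger0_norm //=.
have n0 : (0 < n)%N by exact: leq_ltn_trans Mn.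
rewrite -(@ler_pXn2r _ n) ?nnegrE // ?(ltW e0) // rE // (le_trans (uM n)) //.
rewrite expr_div_n mulrCA ler_piMr ?exprn_ge0 ?(ltW e0) //.
rewrite ler_pdivrMr ?exprn_gt0 // mul1r -natrX.
rewrite (le_trans (ltW (archi_boundP M0))) // ler_nat.
exact: leq_trans (ltnW Mn) (ltnW (ltn_expl _ _)).
Qed.

Lemma dist_spec_eq0 a b :
  dist_spec a b = 0%E <-> rho_null a b /\ rho_null b a.
Proof.
have rho_ge0 x y : (0 <= rho x y :> \bar R)%E.
  rewrite /rho limn_esup_lim; apply: lime_ge; first exact: is_cvg_esups.
  apply: nearW => n.
  apply: (le_trans _ (ereal_sup_ubound (ex_intro2 _ _ n (leqnn n) erefl))).
  by rewrite lee_fin powR_ge0.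
rewrite -!rho_eq0 /dist_spec; split=> [|[-> ->]]; last by rewrite maxxx.
move=> /eqP; rewrite eq_le ge_max => /andP[/andP[a0 b0] _].
have rho0 x y : (rho x y <= 0 :> \bar R)%E -> rho x y = 0%E.
  by move=> xy0; apply/eqP; rewrite eq_le xy0 rho_ge0.
by split; [exact: rho0 a0|exact: rho0 b0].
Qed.

End RhoNull.

(** * Inverses and resolvents *)

Section Invertible.
Context {R : realType} {A : algType R[i]}.
Implicit Types (x y : A) (k z : R[i]).

Lemma invertible1 : invertible (1 : A).
Proof. by exists 1; rewrite !mulr1. Qed.

Lemma invertibleM x y : invertible x -> invertible y -> invertible (x * y).
Proof.
move=> [x' [xx' x'x]] [y' [yy' y'y]]; exists (y' * x'); split.
  by rewrite mulrA -(mulrA x) yy' mulr1.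
by rewrite mulrA -(mulrA y') x'x mulr1.
Qed.

Lemma invertibleZ k x : k != 0 -> invertible x -> invertible (k *: x).
Proof.
move=> k0 [x' [xx' x'x]]; exists (k^-1 *: x').
by rewrite -!scalerAl -!scalerAr !scalerA xx' x'x mulfV // mulVf // !scale1r.
Qed.

Lemma invertibleN x : invertible x -> invertible (- x).
Proof. by rewrite -scaleN1r; apply/invertibleZ; rewrite oppr_eq0 oner_eq0. Qed.

Lemma invertible_sub_scalar x z :
  z != 0 -> invertible (x - z%:A) <-> invertible (1 - z^-1 *: x).
Proof.
move=> z0; have E : x - z%:A = - (z *: (1 - z^-1 *: x)).
  by rewrite scalerBr scalerA mulfV // scale1r opprB.
split=> [xz|xz].
  have -> : 1 - z^-1 *: x = z^-1 *: - (x - z%:A).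
    by rewrite E opprK scalerA mulVf // scale1r.
  by apply: invertibleZ (invertibleN xz); rewrite invr_eq0.
by rewrite E; apply/invertibleN/invertibleZ.
Qed.

End Invertible.

Section Neumann.
Context {R : realType} {A : banachAlgType R[i]}.
Implicit Types (x y : A).

(** The powers of [x] are [O(2^-n)], so that the Neumann series converges
    geometrically. *)
Lemma invertible_1B_top_nilpotent x : top_nilpotent x -> invertible (1 - x).
Proof.
move=> fx; have half_gt0 : 0 < 2^-1 :> R by rewrite invr_gt0.
have [M xM] := fx _ half_gt0.
pose s n := \sum_(i < n) x ^+ i.
have [n|l ls] := @geometric_cvg R A s M.
  by rewrite /s big_ord_recr /= [X in X - _]addrC addrK.
have sx n : (1 - x) * s n = 1 - x ^+ n.
  by rewrite -opprB mulNr -subrX1 opprB.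
have xs n : s n * (1 - x) = 1 - x ^+ n.
  rewrite -sx; apply/commrB; first exact: commr1.
  by apply/commr_sym/commr_sum => i _; apply: commrX.
exists l; split; apply/eqP; rewrite -subr_eq0; apply/eqP;
    apply: (@rnorm_geometric_eq0 _ _ _ (rnorm (1 - x) * (2 * M) + M)) => n.
  have -> : (1 - x) * l - 1 = (1 - x) * (l - s n) - x ^+ n.
    by rewrite mulrBr sx opprB addrAC addrA subrK.
  rewrite [leRHS]mulrDl (le_trans (ler_rnormB _ _)) // lerD // -mulrA.
  by rewrite (le_trans (ler_rnormM _ _)) // ler_wpM2l ?rnorm_ge0.
have -> : l * (1 - x) - 1 = (l - s n) * (1 - x) - x ^+ n.
  by rewrite mulrBl xs opprB addrAC addrA subrK.
rewrite [leRHS]mulrDl (le_trans (ler_rnormB _ _)) // lerD // -mulrA mulrC.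
by rewrite (le_trans (ler_rnormM _ _)) // ler_wpM2r ?rnorm_ge0.
Qed.

End Neumann.

(** * The spectral radius formula for quasinilpotent elements *)

Section Resolvent.
Context {R : realType} {A : banachAlgType R[i]} (q : A) (res : R[i] -> A).
Context (resP : forall z,
  (1 - z *: q) * res z = 1 /\ res z * (1 - z *: q) = 1).
Implicit Types z w : R[i].

Lemma resolvent_identity z w :
  res z - res w = (z - w) *: (res z * q * res w).
Proof.
have -> : res z - res w = res z * ((1 - w *: q) - (1 - z *: q)) * res w.
  by rewrite mulrBr mulrBl (resP z).2 mul1r -mulrA (resP w).1 mulr1.
by rewrite opprB addrC subrKA -scalerBl -scalerAr -scalerAl.
Qed.

Lemma ler_resolvent_sub z w :
  rnorm (res z - res w)
    <= cabs (z - w) * (rnorm (res z) * rnorm q * rnorm (res w)).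
Proof.
rewrite resolvent_identity rnormZ ler_wpM2l ?cabs_ge0 //.
rewrite (le_trans (ler_rnormM _ _)) // ler_wpM2r ?rnorm_ge0 //.
exact: ler_rnormM.
Qed.

(** Near [w] the resolvent is at most twice as large as at [w], by the
    resolvent identity; a compactness argument makes the bound uniform. *)
Lemma resolvent_bounded (L : R) :
  exists2 K, 0 <= K & forall z, cabs z <= L -> rnorm (res z) <= K.
Proof.
have : compact (`[- L, L] `*` `[- L, L] : set (R * R)).
  by apply: compact_setX; exact: segment_compact.
move=> /compact_near_coveringP/(_ nat \oo
  (fun n p => rnorm (res (p.1 +i* p.2)) <= n%:R) _).
case=> [[x y] _ /=|N _ NP]; last first.
  exists N%:R => // -[x y] zL; apply: (NP N (leqnn N) (x, y)).
  have := le_trans (ler_cabs_Re _) zL; have := le_trans (ler_cabs_Im _) zL.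
  by rewrite /= !ler_norml !in_itv /=.
set w := x +i* y; set r := rnorm (res w).
pose d := (4 * (rnorm q * r + 1))^-1.
have r0 : 0 <= r by exact: rnorm_ge0.
have q0 : 0 <= rnorm q by exact: rnorm_ge0.
have d0 : 0 < d by rewrite invr_gt0 mulr_gt0 // ltr_wpDl // mulr_ge0.
exists (ball (x, y) d, [set n | (Num.bound (2 * r) <= n)%N]).
  split; first exact: nbhsx_ballx.
  by exists (Num.bound (2 * r)).
move=> [[x' y'] n] [/= [/= xx' yy'] le_n]; set z := x' +i* y'.
have dz : cabs (z - w) <= 2 * d.
  rewrite (le_trans (cabs_le_ReIm _)) //= mulr_natl mulr2n lerD //.
    by rewrite distrC ltW.
  by rewrite distrC ltW.
have small : cabs (z - w) * (rnorm q * r) <= 2^-1.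
  rewrite (@le_trans _ _ (2 * d * (rnorm q * r + 1))) //.
    by rewrite ler_pM ?cabs_ge0 ?mulr_ge0 // lerDl.
  rewrite /d invfM mulrA -mulrA mulVf ?mulr1; first by lra.
  by rewrite gt_eqF // ltr_wpDl // mulr_ge0.
have := ler_resolvent_sub z w; rewrite -mulrA mulrCA -/r => le_sub.
have := ler_rnormD (res z - res w) (res w); rewrite subrK -/r.
have := archi_boundP (mulr_ge0 (ler0n R 2) r0).
have := le_n; rewrite -(ler_nat R).
have := rnorm_ge0 (res z); move: small le_sub; nra.
Qed.

End Resolvent.

Section SpectralRadius.
Context {R : realType} {A : banachAlgType R[i]}.
Implicit Types (q x y : A) (z w : R[i]).

Fixpoint rootN1 (m : nat) : R[i] := if m is k.+1 then sqrtC (rootN1 k) else -1.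

Lemma rootN1X m : rootN1 m ^+ (2 ^ m) = -1.
Proof. by elim: m => //= m IHm; rewrite expnS exprM sqrtCK. Qed.

Lemma cabs_rootN1 m : cabs (rootN1 m) = 1.
Proof.
apply/eqP; rewrite -(@pexpr_eq1 _ _ (2 ^ m)) ?cabs_ge0 ?expn_gt0 //.
by rewrite -cabsX rootN1X /cabs normrN1.
Qed.

Section PowerResolvents.
Context (q : A) (res : R[i] -> A).
Context (resP : forall z,
  (1 - z *: q) * res z = 1 /\ res z * (1 - z *: q) = 1).

(** The average of the resolvents at the [2^m]-th roots of [z^(2^m)], see
    [power_resP]. *)
Fixpoint power_res (m : nat) z : A :=
  if m is k.+1 then 2^-1 *: (power_res k z + power_res k (rootN1 k * z))
  else res z.

(** By induction on [m], since [1/(1 - t^2)] is the average of [1/(1 - t)] and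
    [1/(1 + t)]. *)
Lemma power_resP m z : let t := (z *: q) ^+ (2 ^ m) in
  (1 - t) * power_res m z = 1 /\ power_res m z * (1 - t) = 1.
Proof.
elim: m z => [|m IHm] z /=; first by rewrite expr1.
set t := (z *: q) ^+ (2 ^ m).
have tN : ((rootN1 m * z) *: q) ^+ (2 ^ m) = - t.
  by rewrite -scalerA exprZn rootN1X scaleN1r.
have /= := IHm z; rewrite -/t => -[y1 y2].
have := IHm (rootN1 m * z); rewrite /= tN opprK.
set y := power_res m z in y1 y2 *; set y' := power_res m _ => -[y'1 y'2].
have -> : (z *: q) ^+ (2 ^ m.+1) = t ^+ 2 by rewrite expnS mulnC exprM.
have f1 : 1 - t ^+ 2 = (1 - t) * (1 + t).
  by rewrite mulrDr mulr1 mulrBl mul1r expr2 subrKA.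
have f2 : 1 - t ^+ 2 = (1 + t) * (1 - t).
  by rewrite mulrBr mulr1 mulrDl mul1r expr2 opprD addrA addrK.
have two : 2^-1 *: (1 + t + (1 - t)) = 1.
  rewrite addrACA subrr addr0 -mulr2n -(scaler_nat 2 (1 : A)) scalerA.
  by rewrite mulVf ?scale1r.
split.
  rewrite -scalerAr mulrDr [in X in X + _]f2 [in X in _ + X]f1.
  by rewrite -!mulrA y1 y'1 !mulr1 two.
rewrite -scalerAl mulrDl [in X in X + _]f1 [in X in _ + X]f2.
by rewrite !mulrA y2 y'2 !mul1r two.
Qed.

(** Averaging does not increase the Lipschitz constant: it is that of the
    resolvent itself, uniformly in [m]. *)
Lemma power_res_lipschitz (L : R) : exists2 K, 0 <= K &
  forall m z w, cabs z <= L -> cabs w <= L ->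
    rnorm (power_res m z - power_res m w) <= K * cabs (z - w).
Proof.
have [B B0 resB] := resolvent_bounded resP L.
exists (B * rnorm q * B); first by rewrite !mulr_ge0 ?rnorm_ge0.
elim=> [|m IHm] z w zL wL /=.
  rewrite (le_trans (ler_resolvent_sub resP _ _)) // mulrC.
  rewrite ler_wpM2r ?cabs_ge0 // ler_pM ?mulr_ge0 ?rnorm_ge0 ?resB //.
  by rewrite ler_wpM2r ?rnorm_ge0 ?resB.
rewrite -scalerBr opprD addrACA rnormZ.
have -> : cabs 2^-1 = 2^-1 :> R.
  by rewrite -(cabs_real (r := 2^-1)) ?invr_ge0 // fmorphV rmorph_nat.
have h1 := IHm z w zL wL.
have := IHm (rootN1 m * z) (rootN1 m * w).
rewrite !cabsM !cabs_rootN1 !mul1r -mulrBr cabsM cabs_rootN1 mul1r.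
move=> /(_ zL wL) h2; have := le_trans (ler_rnormD _ _) (lerD h1 h2).
lra.
Qed.

(** If [(s q)^(2^m)] tends to 0 then [power_res m s] tends to 1, so that
    [power_res m s'] stays within [1/2] of 1 for [s'] in a neighbourhood whose
    size does not depend on [s]; this bounds [(s' q)^(2^m)]. *)
Lemma power_res_step (K L s s' : R) : 0 <= K ->
  (forall m z w, cabs z <= L -> cabs w <= L ->
    rnorm (power_res m z - power_res m w) <= K * cabs (z - w)) ->
  0 <= s <= L -> 0 <= s' <= L -> K * `|s - s'| <= 4^-1 ->
  (\forall m \near \oo,
     rnorm ((s%:C *: q) ^+ (2 ^ m)) <= (8 * rnorm (1 : A))^-1) ->
  \forall m \near \oo, rnorm ((s'%:C *: q) ^+ (2 ^ m)) <= 1.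
Proof.
move=> K0 lipK /andP[s0 sL] /andP[s'0 s'L] ss'; apply: filterS => m small.
have [_] := power_resP m s%:C; have [] := power_resP m s'%:C.
have := lipK m s'%:C s%:C; rewrite !cabs_real // => /(_ s'L sL).
set t := (s%:C *: q) ^+ _ in small *; set t' := (s'%:C *: q) ^+ _.
set y := power_res m s%:C; set y' := power_res m s'%:C => yy' y'1 _ y1.
have {yy'} yy' : rnorm (y' - y) <= 4^-1.
  rewrite (le_trans yy') // -rmorphB (le_trans _ ss') // ler_wpM2l //.
  rewrite (le_trans (cabs_le_ReIm _)) //= normr0 addr0 distrC //.
(* The norm of [1] may exceed 1, hence the bound [(8 * rnorm 1)^-1] on [t]. *)
have e1 : 1 <= rnorm (1 : A).
  have := ler_rnormM (1 : A) 1; rewrite mulr1 ler_pMr //.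
  exact: rnorm1_gt0.
have yE : y - 1 = y * t by rewrite -y1 mulrBr mulr1 opprB addrC subrK.
have y_near1 : rnorm (y - 1) <= 4^-1.
  have h : rnorm (y - 1) <= (rnorm (1 : A) + rnorm (y - 1)) * rnorm t.
    rewrite {1}yE (le_trans (ler_rnormM _ _)) // ler_wpM2r ?rnorm_ge0 //.
    by rewrite -[in leLHS](subrKC 1 y) ler_rnormD.
  have h1 : rnorm (1 : A) * rnorm t <= 8^-1.
    have := ler_wpM2l (rnorm_ge0 (1 : A)) small.
    by rewrite invfM mulrCA mulfV ?mulr1 // gt_eqF // rnorm1_gt0.
  have h2 : rnorm t <= rnorm (1 : A) * rnorm t.
    by rewrite ler_peMl ?rnorm_ge0.
  have := rnorm_ge0 (y - 1); have := rnorm_ge0 t; nra.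
have y'_near1 : rnorm (y' - 1) <= 2^-1.
  rewrite -(subrKA y) (le_trans (ler_rnormD _ _)) //.
  by move: yy' y_near1; lra.
have t'E : t' = (y' - 1) - t' * (y' - 1).
  have -> : y' - 1 = t' * y' by rewrite -y'1 mulrBl mul1r opprB addrC subrK.
  by rewrite -mulrBr -{1}[y']mul1r -mulrBl y'1 mulr1.
have : rnorm t' <= 2^-1 + rnorm t' * 2^-1.
  rewrite {1}t'E (le_trans (ler_rnormB _ _)) // lerD //.
  by rewrite (le_trans (ler_rnormM _ _)) // ler_wpM2l ?rnorm_ge0.
by lra.
Qed.

End PowerResolvents.

(** A slightly smaller radius turns boundedness into convergence to 0. *)
Lemma near_pow2_shrink q (s s' e : R) : 0 <= s < s' -> 0 < e ->
  (\forall m \near \oo, rnorm ((s'%:C *: q) ^+ (2 ^ m)) <= 1) ->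
  \forall m \near \oo, rnorm ((s%:C *: q) ^+ (2 ^ m)) <= e.
Proof.
move=> /andP[s0 ss'] e0 bnd; have s'0 : 0 < s' by exact: le_lt_trans ss'.
have r0 : 0 <= s / s' by rewrite divr_ge0 // ltW.
have r1 : s / s' < 1 by rewrite ltr_pdivrMr // mul1r.
have : (fun m => (s / s') ^+ m) @ \oo --> (0 : R).
  by apply: cvg_expr; rewrite ger0_norm.
move=> /cvgrPdist_le/(_ e e0); apply: filterS2 bnd => m bnd.
rewrite sub0r normrN ger0_norm ?exprn_ge0 // => small.
have -> : s%:C = (s / s')%:C * s'%:C by rewrite -rmorphM /= divfK // gt_eqF.
rewrite -scalerA exprZn rnormZ cabsX cabs_real // -[leRHS]mulr1.
rewrite ler_pM ?exprn_ge0 ?rnorm_ge0 // (le_trans _ small) //.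
by rewrite ler_wiXn2l ?(ltW r1) // ltnW // ltn_expl.
Qed.

(** By [power_res_step] and [near_pow2_shrink] the radii [s] for which
    [(s q)^(2^m)] tends to 0 can be enlarged by a fixed amount [d], as long as
    they stay in a given bounded interval; so they reach [e^-1]. *)
Lemma top_nilpotent_resolvent q :
  (forall z, invertible (1 - z *: q)) -> top_nilpotent q.
Proof.
move=> inv_q; have [res resP] := boolp.choice inv_q.
apply: top_nilpotentP => e e0; set s := e^-1.
have s0 : 0 < s by rewrite invr_gt0.
have [K K0 lipK] := power_res_lipschitz resP (s + 2).
pose k := Num.bound (s * (8 * K + 1)).
have K1 : 0 < 8 * K + 1 by rewrite ltr_wpDl // mulr_ge0.
have k_big : s * (8 * K + 1) < k%:R.
  by apply: archi_boundP; rewrite ltW // mulr_gt0.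
have k0 : 0 < k%:R :> R by apply: lt_trans k_big; rewrite mulr_gt0.
(* The [k] steps of length [d] end at [s]; moreover [2 d K <= 1/4] as
   [power_res_step] requires, and [d < 1] keeps all radii below [s + 2]. *)
pose d := s / k%:R.
have d0 : 0 < d by rewrite divr_gt0.
have dK : d * (8 * K + 1) < 1.
  by rewrite /d mulrAC ltr_pdivrMr // mul1r.
have d1 : d < 1.
  by apply: le_lt_trans dK; rewrite ler_peMr ?(ltW d0) // lerDr mulr_ge0.
have conv j : (j <= k)%N -> forall eps, 0 < eps ->
    \forall m \near \oo, rnorm (((d * j%:R)%:C *: q) ^+ (2 ^ m)) <= eps.
  elim: j => [_|j IHj lt_jk] eps eps0.
    apply: nearW => m; rewrite mulr0 scale0r expr0n expn_eq0 /= rnorm0.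
    exact: ltW.
  have dj : 0 <= d * j%:R by rewrite mulr_ge0 // ltW.
  have djs : d * j.+1%:R <= s.
    rewrite /d -mulrA ler_piMr ?(ltW s0) // mulrC ler_pdivrMr // mul1r.
    by rewrite ler_nat.
  move: djs; rewrite -natr1 mulrDr mulr1 => djs.
  apply: (@near_pow2_shrink _ _ (d * j%:R + 2 * d)) => //; first by lra.
  apply: (power_res_step resP (s := d * j%:R) K0 lipK).
  - by lra.
  - by lra.
  - rewrite opprD addNKr normrN ger0_norm; last by lra.
    by move: dK; lra.
  - apply: IHj; first exact: ltnW.
    by rewrite invr_gt0 mulr_gt0 // rnorm1_gt0.
have [N _ /(_ N (leqnn N))] := conv k (leqnn k) 1 ltr01.
rewrite /d divfK ?gt_eqF // exprZn rnormZ cabsX cabs_real ?(ltW s0) // => bnd.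
exists (2 ^ N)%N; first by rewrite expn_gt0.
by move: bnd; rewrite /s exprVn mulrC ler_pdivrMr ?exprn_gt0 // mul1r.
Qed.

Lemma quasinilpotentP x : quasinilpotent x <-> top_nilpotent x.
Proof.
split=> [qx|fx].
  apply: top_nilpotent_resolvent => z; have [->|z0] := eqVneq z 0.
    by rewrite scale0r subr0; apply: invertible1.
  have : invertible (x - z^-1%:A).
    apply: contrapT => nz; have : spectrum x z^-1 by [].
    by rewrite qx /= => /eqP; rewrite invr_eq0 (negPf z0).
  by rewrite invertible_sub_scalar ?invr_eq0 // invrK.
apply/seteqP; split=> [z /= zx|z /= ->].
  apply: contrapT => /eqP z0; apply: zx; apply/invertible_sub_scalar => //.
  exact/invertible_1B_top_nilpotent/top_nilpotentZ.
move=> [y]; rewrite scale0r subr0 => -[xy yx].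
have : top_nilpotent (1 : A).
  by rewrite -xy; apply: top_nilpotentM => //; rewrite /GRing.comm xy yx.
move=> one; have : (1 : A) = 0.
  apply: (@fast_decay_geometric _ _ 1); first exact: oner_neq0.
  by apply: eq_fast_decay one => n; rewrite !expr1n scale1r.
by move/eqP; rewrite oner_eq0.
Qed.

End SpectralRadius.

(** * The bicommutant and polynomial calculus *)

Section Bicommutant.
Context {R : realType} {A : algType R[i]}.
Implicit Types (x y z : A) (k : R[i]) (p : {poly R[i]}).

(** Everything that is built from [a] below lies in its bicommutant; so its
    elements commute with each other and with all that commutes with [a]. *)
Definition bicommutant x : set A :=
  [set y | forall z, GRing.comm z x -> GRing.comm z y].

Lemma bicommutant_refl x : bicommutant x x.
Proof. by []. Qed.

Lemma bicommutant_trans x y z :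
  bicommutant x y -> bicommutant y z -> bicommutant x z.
Proof. by move=> xy yz w /xy/yz. Qed.

Lemma bicommutant_comm x y : bicommutant x y -> GRing.comm x y.
Proof. by apply; apply: commr_refl. Qed.

Lemma bicommutant_comm2 x y z :
  bicommutant x y -> bicommutant x z -> GRing.comm y z.
Proof. by move=> xy; apply; apply/commr_sym/bicommutant_comm. Qed.

Lemma bicommutant1 x : bicommutant x 1.
Proof. by move=> z _; apply: commr1. Qed.

Lemma bicommutantD x y z :
  bicommutant x y -> bicommutant x z -> bicommutant x (y + z).
Proof. by move=> xy xz w wx; apply: commrD; [apply: xy|apply: xz]. Qed.

Lemma bicommutantB x y z :
  bicommutant x y -> bicommutant x z -> bicommutant x (y - z).
Proof. by move=> xy xz w wx; apply: commrB; [apply: xy|apply: xz]. Qed.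

Lemma bicommutantM x y z :
  bicommutant x y -> bicommutant x z -> bicommutant x (y * z).
Proof. by move=> xy xz w wx; apply: commrM; [apply: xy|apply: xz]. Qed.

Lemma bicommutantX x y n : bicommutant x y -> bicommutant x (y ^+ n).
Proof. by move=> xy w wx; apply: commrX; apply: xy. Qed.

Lemma bicommutantZ x k y : bicommutant x y -> bicommutant x (k *: y).
Proof.
by move=> xy w /xy wy; rewrite /GRing.comm -scalerAr -scalerAl wy.
Qed.

Lemma bicommutant_sum x I (r : seq I) (P : pred I) (F : I -> A) :
  (forall i, P i -> bicommutant x (F i)) ->
  bicommutant x (\sum_(i <- r | P i) F i).
Proof. by move=> xF w wx; apply: commr_sum => i Pi; apply: xF. Qed.

Lemma bicommutantMn x y n : bicommutant x y -> bicommutant x (y *+ n).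
Proof. by move=> xy w wx; apply: commrMn; apply: xy. Qed.

Lemma bicommutant_horner x p : bicommutant x (horner_alg x p).
Proof.
elim/poly_ind: p => [|p k IHp]; first by rewrite rmorph0 => w _; apply: commr0.
rewrite rmorphD rmorphM /= horner_algX horner_algC.
by apply/bicommutantD/bicommutantZ/bicommutant1/bicommutantM.
Qed.

Lemma horner_algZ x k p : horner_alg x (k *: p) = k *: horner_alg x p.
Proof. by rewrite -mul_polyC rmorphM /= horner_algC mulr_algl. Qed.

(** The linear factors of [p] give invertible factors of [p(x)]. *)
Lemma horner_alg_invertible x p : p != 0 ->
  (forall k, root p k -> invertible (x - k%:A)) ->
  invertible (horner_alg x p).
Proof.
move=> p0 inv_root; have [r pE] := closed_field_poly_normal p.
have r_root k : k \in r -> root p k.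
  move=> kr; rewrite pE rootE hornerZ mulf_eq0; apply/orP; right.
  by rewrite -rootE root_prod_XsubC.
rewrite pE horner_algZ; apply: invertibleZ; first by rewrite lead_coef_eq0.
rewrite rmorph_prod /=; elim: r r_root {pE} => [|z r IHr] r_root.
  by rewrite big_nil; apply: invertible1.
rewrite big_cons; apply: invertibleM.
  rewrite rmorphB /= horner_algX horner_algC.
  by apply/inv_root/r_root; rewrite mem_head.
by apply: IHr => w wr; apply: r_root; rewrite inE wr orbT.
Qed.

End Bicommutant.

Section SpectralCalculus.
Context {R : realType} {A : banachAlgType R[i]}.
Implicit Types (x y : A) (p : {poly R[i]}) (s : seq R[i]).

(** Spectral mapping: the roots of [1 - z p] are outside the spectrum of [x], so
    that [1 - z p(x)] is invertible for all [z]. A point of [s] is needed to see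
    that [1 - z p] is not the zero polynomial. *)
Lemma top_nilpotent_horner x p s :
  s != [::] -> (forall z, spectrum x z -> z \in s) ->
  (forall z, z \in s -> p.[z] = 0) -> top_nilpotent (horner_alg x p).
Proof.
move=> s0 xs ps; apply: top_nilpotent_resolvent => z.
have -> : 1 - z *: horner_alg x p = horner_alg x (1 - z *: p).
  by rewrite rmorphB rmorph1 /= horner_algZ.
apply: horner_alg_invertible => [|w].
  case: s s0 ps {xs} => // w s _ ps; apply/eqP => /(congr1 (horner^~ w)).
  rewrite hornerD hornerN hornerZ hornerC ps ?mem_head // mulr0 subr0 horner0.
  by move/eqP; rewrite oner_eq0.
rewrite rootE hornerD hornerN hornerZ hornerC => root_w; apply: contrapT.
move=> /xs/ps pw; move: root_w; rewrite pw mulr0 subr0 oner_eq0 //.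
Qed.

Lemma bicommutant_closed x y (u : nat -> A) (M : R) :
  (forall n, bicommutant x (u n)) ->
  (forall n, rnorm (y - u n) <= M * 2^-1 ^+ n) -> bicommutant x y.
Proof.
move=> xu yu w wx; apply/eqP; rewrite -subr_eq0; apply/eqP.
apply: (@rnorm_geometric_eq0 _ _ _ (2 * rnorm w * M)) => n.
have -> : w * y - y * w = w * (y - u n) - (y - u n) * w.
  by rewrite mulrBr mulrBl (xu n w wx) opprB addrA subrK.
rewrite (le_trans (ler_rnormB _ _)) //.
have -> : 2 * rnorm w * M * 2^-1 ^+ n =
  rnorm w * (M * 2^-1 ^+ n) + (M * 2^-1 ^+ n) * rnorm w by ring.
rewrite lerD // (le_trans (ler_rnormM _ _)) //.
  by rewrite ler_wpM2l ?rnorm_ge0.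
by rewrite ler_wpM2r ?rnorm_ge0.
Qed.

End SpectralCalculus.

(** * Lifting idempotents *)

Section IdempotentLift.
Context {R : realType} {A : banachAlgType R[i]}.
Implicit Types (e x y : A).

(** Cut the binomial expansion of [1 = (e + (1 - e))^(2n)] in the middle: the
    first half is divisible by [e^n], the other one by [(1 - e)^n], and the
    cofactors grow at most exponentially. *)
Lemma bernstein_split e : exists2 K : R, 0 < K & exists C : R, forall n,
  exists S T : A, [/\ e ^+ n * S + (1 - e) ^+ n * T = 1,
    bicommutant e S, bicommutant e T, rnorm S <= C * K ^+ n
    & rnorm T <= C * K ^+ n].
Proof.
set f := 1 - e; pose k := 1 + rnorm e + rnorm f; pose m := rnorm (1 : A) ^+ 2.
have k0 : 0 < k by rewrite /k -addrA ltr_pwDl // addr_ge0 ?rnorm_ge0.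
have ef : bicommutant e f.
  by apply: bicommutantB; [exact: bicommutant1|exact: bicommutant_refl].
have mono n i : (i <= n)%N -> rnorm (e ^+ (n - i) * f ^+ i) <= m * k ^+ n.
  move=> le_in; rewrite (le_trans (ler_rnormM _ _)) //.
  have -> : m * k ^+ n =
      (rnorm (1 : A) * k ^+ (n - i)) * (rnorm (1 : A) * k ^+ i).
    by rewrite mulrACA -exprD subnK.
  rewrite ler_pM ?rnorm_ge0 // (le_trans (ler_rnormX _ _)) //;
    rewrite ler_wpM2l ?rnorm_ge0 // lerXn2r // ?nnegrE ?rnorm_ge0 ?(ltW k0) //.
    by rewrite /k addrAC lerDr addr_ge0 ?rnorm_ge0.
  by rewrite /k lerDr addr_ge0 ?rnorm_ge0.
have mk0 n : 0 <= m * k ^+ n by rewrite mulr_ge0 ?sqr_ge0 ?exprn_ge0 ?(ltW k0).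
have sum_le n d (P : pred 'I_d) (c : 'I_d -> nat) (F : 'I_d -> A) :
    (\sum_(i < d | P i) c i <= 2 ^ (n + n))%N ->
    (forall i, rnorm (F i) <= m * k ^+ n) ->
    rnorm (\sum_(i < d | P i) F i *+ c i) <= m * (4 * k) ^+ n.
  move=> cn Fm; rewrite (le_trans (ler_rnorm_sum _ _ _)) //.
  rewrite (@le_trans _ _ (\sum_(i < d | P i) (m * k ^+ n) *+ c i)) //.
    apply: ler_sum => i _; rewrite (le_trans (ler_rnormMn _ _)) //.
    by rewrite lerMn2r Fm orbT.
  rewrite sumrMnr -[leLHS]mulr_natl exprMn [leRHS]mulrCA ler_wpM2r //.
  by rewrite -natrX ler_nat -[4%N]/(2 ^ 2)%N -expnM mulnC muln2 -addnn.
have binomials n :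
    (\sum_(i < n) 'C(n + n, i) + \sum_(i < n.+1) 'C(n + n, n + i))%N =
    (2 ^ (n + n))%N.
  rewrite -[2%N]/(1 + 1)%N expnDn -addnS big_split_ord /=.
  by congr (_ + _)%N; apply: eq_bigr => i _; rewrite !exp1n !muln1.
exists (4 * k); first by rewrite mulr_gt0.
exists m => n.
exists (\sum_(i < n) (e ^+ (n - i) * f ^+ i) *+ 'C(n + n, i)).
exists (\sum_(i < n.+1) (e ^+ (n - i) * f ^+ i) *+ 'C(n + n, n + i)).
split.
- have <- : (e + f) ^+ (n + n) = 1 by rewrite subrKC expr1n.
  rewrite (exprDn_comm _ (bicommutant_comm ef)) -addnS big_split_ord /=.
  rewrite !mulr_sumr; congr (_ + _).
    apply: eq_bigr => i _; rewrite mulrnAr mulrA -exprD addnBA //.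
    by rewrite ltnW.
  apply: eq_bigr => i _; rewrite mulrnAr mulrA.
  have -> : f ^+ n * e ^+ (n - i) = e ^+ (n - i) * f ^+ n.
    by apply/commrX/commr_sym/commrX/bicommutant_comm.
  by rewrite -mulrA -exprD subnDl.
- by apply: bicommutant_sum => i _; apply/bicommutantMn/bicommutantM;
    apply: bicommutantX => //; exact: bicommutant_refl.
- by apply: bicommutant_sum => i _; apply/bicommutantMn/bicommutantM;
    apply: bicommutantX => //; exact: bicommutant_refl.
- apply: sum_le => [|i]; first by rewrite -binomials leq_addr.
  by apply: mono; rewrite ltnW.
- apply: sum_le => [|i]; first by rewrite -binomials leq_addl.
  by apply: mono; rewrite -ltnS.
Qed.

(** The lower halves [u n = e^n S_n] of the expansions form a Cauchy sequence:
    up to commuting factors of exponential growth, [u (n+1) - u n] and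
    [u n (1 - u n)] are multiples of [(e (1 - e))^n]. *)
Lemma idempotent_lift e : top_nilpotent (e * (1 - e)) ->
  exists p, [/\ p * p = p, bicommutant e p & top_nilpotent (e - p)].
Proof.
set f := 1 - e => ft.
have [K K0 [C /boolp.choice[S /boolp.choice[T ST]]]] := bernstein_split e.
rewrite -/f in ST.
have ef : bicommutant e f.
  by apply: bicommutantB; [exact: bicommutant1|exact: bicommutant_refl].
have bS n : bicommutant e (S n) by have [] := ST n.
have bT n : bicommutant e (T n) by have [] := ST n.
have beX n : bicommutant e (e ^+ n) by exact/bicommutantX/bicommutant_refl.
have bfX n : bicommutant e (f ^+ n) by exact/bicommutantX.
have tX n : (e * f) ^+ n = e ^+ n * f ^+ n.
  by rewrite exprMn_comm //; exact: bicommutant_comm.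
pose u n := e ^+ n * S n; pose v n := f ^+ n * T n.
have uv n : u n + v n = 1 by have [] := ST n.
have bu n : bicommutant e (u n) by apply: bicommutantM.
have bv n : bicommutant e (v n) by apply: bicommutantM.
have uvE m n : u m * v n = e ^+ m * f ^+ n * (S m * T n).
  rewrite /u /v !mulrA; congr (_ * _); rewrite -!mulrA; congr (_ * _).
  exact: bicommutant_comm2 (bS m) (bfX n).
have C0 : 0 <= C.
  have [_ _ _ + _] := ST 0%N; rewrite expr0 mulr1; exact/le_trans/rnorm_ge0.
have STb m n : rnorm (S m * T n) <= C ^+ 2 * K ^+ (m + n).
  have [_ _ _ Sm _] := ST m; have [_ _ _ _ Tn] := ST n.
  rewrite (le_trans (ler_rnormM _ _)) // exprD expr2 mulrACA.
  by rewrite ler_pM ?rnorm_ge0.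
have rate_gt0 : 0 < (2 * K ^+ 2)^-1 by rewrite invr_gt0 mulr_gt0 ?exprn_gt0.
have [M0 tM] := ft _ rate_gt0.
have M00 := decay_const_ge0 tM.
(* The rate [(2 K^2)^-1] leaves a factor [2^-n] after multiplication by [S] and
   [T]. *)
have tST n d : (d <= 1)%N -> rnorm ((e * f) ^+ n) * (C ^+ 2 * K ^+ (n + n + d))
    <= M0 * C ^+ 2 * (1 + K) * 2^-1 ^+ n.
  move=> d1; have Kd : K ^+ d <= 1 + K.
    by case: d d1 => [|[|//]] _; rewrite ?expr0 ?expr1 ?lerDl ?lerDr // ltW.
  have -> : M0 * C ^+ 2 * (1 + K) * 2^-1 ^+ n =
      M0 * (2 * K ^+ 2)^-1 ^+ n * (C ^+ 2 * (K ^+ (n + n) * (1 + K))).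
    rewrite addnn -mul2n exprM invfM exprMn exprVn.
    have : K ^+ 2 ^+ n != 0 by rewrite !expf_neq0 // gt_eqF.
    have : (2 : R) ^+ n != 0 by rewrite expf_neq0 ?pnatr_eq0.
    rewrite (exprVn (K ^+ 2)); set a := K ^+ 2 ^+ n; set b := 2 ^+ n => b0 a0.
    by field; rewrite a0 b0.
  rewrite ler_pM ?rnorm_ge0 ?mulr_ge0 ?sqr_ge0 ?exprn_ge0 ?(ltW K0) //.
  by rewrite ler_wpM2l ?sqr_ge0 // exprD ler_wpM2l // exprn_ge0 // ltW.
pose D := M0 * C ^+ 2 * (1 + K).
have D0 : 0 <= D by rewrite !mulr_ge0 ?sqr_ge0 // addr_ge0 // ltW.
have [n|p pu] := @geometric_cvg R A u ((rnorm e + rnorm f) * D).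
  have -> : u n.+1 - u n = u n.+1 * v n - u n * v n.+1.
    transitivity (u n.+1 * (u n + v n) - u n * (u n.+1 + v n.+1)).
      by rewrite !uv !mulr1.
    rewrite !mulrDr (bicommutant_comm2 (bu n.+1) (bu n)).
    by rewrite opprD addrACA subrr add0r.
  have -> : u n.+1 * v n = e * ((e * f) ^+ n * (S n.+1 * T n)).
    by rewrite uvE tX exprS !mulrA.
  have -> : u n * v n.+1 = f * ((e * f) ^+ n * (S n * T n.+1)).
    rewrite uvE tX exprS !mulrA; congr (_ * _ * _ * _).
    exact: bicommutant_comm2 (beX n) ef.
  rewrite (le_trans (ler_rnormB _ _)) // -[leRHS]mulrA [leRHS]mulrDl lerD //.
    rewrite (le_trans (ler_rnormM _ _)) // ler_wpM2l ?rnorm_ge0 //.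
    rewrite (le_trans (ler_rnormM _ _)) // (le_trans _ (tST n 1%N _)) //.
    by rewrite ler_wpM2l ?rnorm_ge0 // addn1 -addSn.
  rewrite (le_trans (ler_rnormM _ _)) // ler_wpM2l ?rnorm_ge0 //.
  rewrite (le_trans (ler_rnormM _ _)) // (le_trans _ (tST n 1%N _)) //.
  by rewrite ler_wpM2l ?rnorm_ge0 // addn1 -addnS.
set B := 2 * _ in pu.
have bp : bicommutant e p by exact: bicommutant_closed pu.
have B0 : 0 <= B by rewrite mulr_ge0 // mulr_ge0 // addr_ge0 ?rnorm_ge0.
exists p; split=> //.
  have puB n : rnorm (p - u n) <= B.
    rewrite (le_trans (pu n)) // ler_piMr // exprn_ile1 ?invr_ge0 //.
    by rewrite invf_le1 ?ler1n.
  have uvD n : rnorm (u n * v n) <= D * 2^-1 ^+ n.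
    rewrite uvE -tX (le_trans (ler_rnormM _ _)) //.
    rewrite (le_trans _ (tST n 0%N _)) //.
    by rewrite addn0 ler_wpM2l ?rnorm_ge0.
  apply/eqP; rewrite eq_sym -subr_eq0; apply/eqP.
  apply: (@rnorm_geometric_eq0 _ _ _
    (B * rnorm (1 - p) + D + (rnorm p + B) * B)) => n.
  have -> : p - p * p = (p - u n) * (1 - p) + u n * v n - u n * (p - u n).
    have -> : v n = 1 - u n by rewrite -(uv n) [X in X - _]addrC addrK.
    by rewrite -addrA -mulrBr opprB subrKA -mulrDl subrK mulrBr mulr1.
  rewrite [leRHS]mulrDl [X in _ <= X + _]mulrDl.
  rewrite (le_trans (ler_rnormB _ _)) // lerD //.
    rewrite (le_trans (ler_rnormD _ _)) // lerD //.
    rewrite (le_trans (ler_rnormM _ _)) // mulrAC ler_wpM2r ?rnorm_ge0 //.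
  rewrite (le_trans (ler_rnormM _ _)) // -mulrA ler_pM ?rnorm_ge0 //.
  rewrite -[in leLHS](subKr p (u n)) (le_trans (ler_rnormB _ _)) // lerD2l //.
apply: top_nilpotent_closed => eps eps0.
have [n n0 Bn] : exists2 n, (0 < n)%N & B * 2^-1 ^+ n <= eps.
  exists (Num.bound (B / eps)).+1 => //.
  have := archi_boundP (divr_ge0 B0 (ltW eps0)); rewrite ltr_pdivrMr // => lt_B.
  rewrite exprVn ler_pdivrMr ?exprn_gt0 // (le_trans (ltW lt_B)) // mulrC.
  rewrite ler_pM2l // -natrX ler_nat.
  by rewrite ltnW // (leq_trans (ltnSn _)) // ltnW // ltn_expl.
exists (e - u n); split.
- apply: (@bicommutant_comm2 _ _ e); apply: bicommutantB => //.
- have [k def_n] : exists k, n = k.+1 by exists n.-1; rewrite prednK.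
  have -> : e - u n = e * f * (f ^+ k * T n - e ^+ k * S n).
    have -> : e - u n = e * v n - f * u n.
      have -> : v n = 1 - u n by rewrite -(uv n) [X in X - _]addrC addrK.
      by rewrite mulrBr mulr1 /f mulrBl mul1r opprB subrKA.
    rewrite mulrBr -!mulrA; congr (_ - _).
      by rewrite /v def_n exprS -!mulrA.
    rewrite /u def_n exprS !mulrA; congr (_ * _ * _).
    exact/esym/bicommutant_comm.
  apply: top_nilpotentM => //; apply: (@bicommutant_comm2 _ _ e).
    by apply: bicommutantM => //; exact: bicommutant_refl.
  by apply: bicommutantB; apply: bicommutantM.
- by rewrite opprB addrC subrKA rnormBC (le_trans (pu n)).
Qed.

End IdempotentLift.

(** * The diagonal part of an element of finite spectrum *)

Section Diagonal.
Context {R : realType} {A : banachAlgType R[i]}.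
Implicit Types (a b c p : A) (s : seq (R[i] * A)) (r : seq R[i]).

(** [s] lists eigenvalues of [c] with spectral projections. Refining such a list
    may produce zero projections and repeat eigenvalues, so both are allowed. *)
Definition diagonalizes s c : Prop :=
  \sum_(j <- s) j.2 = 1 /\
  forall j, j \in s -> c * j.2 = j.1 *: j.2 /\ j.2 * c = j.1 *: j.2.

(** Compressed to two spectral projections, the commutator with [c] is the
    multiplication by the difference of the eigenvalues. *)
Lemma diagonal_comm s c b : diagonalizes s c ->
  fast_decay (fun n => iter n (commutator_op c c) b) -> GRing.comm c b.
Proof.
move=> [s1 sc] fb.
have corner j l : j \in s -> l \in s ->
    j.1 *: (j.2 * b * l.2) = l.1 *: (j.2 * b * l.2).
  move=> js ls; have [->//|jl] := eqVneq j.1 l.1.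
  suff -> : j.2 * b * l.2 = 0 by rewrite !scaler0.
  apply: (@fast_decay_geometric _ _ (j.1 - l.1)); first by rewrite subr_eq0.
  apply: eq_fast_decay (fast_decayMr l.2 (fast_decayMl j.2 fb)).
  elim=> [|n IHn]; first by rewrite expr0 scale1r.
  rewrite iterS exprS -scalerA -IHn {1}/commutator_op mulrBr mulrBl.
  rewrite [_ * (c * _)]mulrA (sc j js).2 -!mulrA (sc l ls).1.
  by rewrite -!scalerAr -!scalerAl scalerBl.
have cE : c = \sum_(j <- s) j.1 *: j.2.
  rewrite -[LHS]mulr1 -s1 mulr_sumr; apply: eq_big_seq => j js.
  by rewrite (sc j js).1.
rewrite /GRing.comm -[c * b]mulr1 -[b * c]mul1r -s1 cE.
rewrite [b * _]mulr_sumr [_ * b]mulr_suml !mulr_suml.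
apply: eq_big_seq => j js; rewrite !mulr_sumr; apply: eq_big_seq => l ls.
by rewrite -!scalerAl -!scalerAr !mulrA corner.
Qed.

Lemma diagonalizesD s c p (k : R[i]) : diagonalizes s c ->
  p * p = p -> GRing.comm p c -> (forall j, j \in s -> GRing.comm p j.2) ->
  diagonalizes ([seq (j.1 + k, j.2 * p) | j <- s] ++
                [seq (j.1, j.2 * (1 - p)) | j <- s]) (c + k *: p).
Proof.
move=> [s1 sc] pp pc ps; split.
  rewrite big_cat !big_map -!mulr_suml s1 /= !mul1r subrKC //.
have p1 : p * (1 - p) = 0 by rewrite mulrBr mulr1 pp subrr.
have p'p : (1 - p) * p = 0 by rewrite mulrBl mul1r pp subrr.
move=> j; rewrite mem_cat => /orP[] /mapP[l ls ->] /=;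
  have [cl lc] := sc l ls; have pl := ps l ls; split.
- rewrite mulrDl mulrA cl -scalerAl -scalerAl mulrA pl -mulrA pp.
  by rewrite scalerDl.
- rewrite mulrDr -mulrA pc mulrA lc -scalerAl -scalerAr -mulrA pp.
  by rewrite scalerDl.
- rewrite mulrDl mulrA cl -!scalerAl mulrA pl -mulrA p1.
  by rewrite mulr0 scaler0 addr0.
- have c1 : (1 - p) * c = c * (1 - p) by rewrite mulrBl mulrBr pc mul1r mulr1.
  rewrite mulrDr -mulrA c1 mulrA lc -scalerAl -scalerAr -mulrA p'p.
  by rewrite mulr0 scaler0 addr0.
Qed.

Lemma top_nilpotent_sum a (I : eqType) (r : seq I) (F : I -> A) :
  (forall i, i \in r -> bicommutant a (F i)) ->
  (forall i, i \in r -> top_nilpotent (F i)) ->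
  top_nilpotent (\sum_(i <- r) F i).
Proof.
elim: r => [_ _|i r IHr bF tF]; first by rewrite big_nil; exact: top_nilpotent0.
have sub j : j \in r -> j \in i :: r by rewrite inE orbC => ->.
rewrite big_cons; apply: top_nilpotentD; last 2 first.
- by apply: tF; rewrite mem_head.
- by apply: IHr => j /sub; [exact: bF|exact: tF].
apply: (@bicommutant_comm2 _ _ a); first by apply: bF; rewrite mem_head.
by rewrite big_seq; apply: bicommutant_sum => j /sub; exact: bF.
Qed.

(** The witnesses are the Lagrange polynomials. *)
Lemma lagrange r : uniq r -> exists L : R[i] -> {poly R[i]},
  forall k z, k \in r -> z \in r -> (L k).[z] = (z == k)%:R.
Proof.
move=> ur; exists (fun k => \prod_(w <- rem k r) ((k - w)^-1 *: ('X - w%:P))).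
move=> k z kr zr; rewrite horner_prod; have [->|zk] := eqVneq z k.
  rewrite big1_seq // => w /=; rewrite mem_rem_uniq // inE => /andP[wk _].
  by rewrite hornerZ hornerXsubC mulVf // subr_eq0 eq_sym.
have zs : z \in rem k r by rewrite mem_rem_uniq // inE zk.
by rewrite (big_rem z) //= hornerZ hornerXsubC subrr mulr0 mul0r.
Qed.

(** Lift the elements [L_k(a)], whose polynomials take the values 0 and 1 on the
    spectrum, to idempotents [P k]; as [z - \sum_k k L_k(z)] vanishes on the
    spectrum too, [c = \sum_k k P_k] differs from [a] by a topologically
    nilpotent element. *)
Lemma diagonal_part a : finite_set (spectrum a) ->
  exists c s, [/\ bicommutant a c, top_nilpotent (a - c), diagonalizes s c
    & forall j, j \in s -> bicommutant a j.2].
Proof.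
move=> /finite_seqP[r0 r0E].
(* The point 0 ensures that the list of [top_nilpotent_horner] is not empty. *)
pose r := undup (0 :: r0).
have ur : uniq r by exact: undup_uniq.
have ar z : spectrum a z -> z \in r.
  by rewrite r0E /= mem_undup inE => ->; rewrite orbT.
have r0r : 0 \in r by rewrite mem_undup mem_head.
have rN : r != [::] by apply: contraTneq r0r => ->.
have [L LE] := lagrange ur.
have lift k : exists p, k \in r -> [/\ p * p = p, bicommutant a p
    & top_nilpotent (horner_alg a (L k) - p)].
  have [kr|//] := boolP (k \in r); last by exists 0.
  have [|p [pp Lp tp]] := @idempotent_lift R A (horner_alg a (L k)).
    rewrite -(rmorph1 (horner_alg a)) -rmorphB -rmorphM /=.
    apply: (top_nilpotent_horner rN ar) => z zr.
    rewrite !(hornerM, hornerD, hornerN, hornerC) LE //.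
    by case: eqP; rewrite ?subrr ?mulr0 ?mul0r.
  exists p; split=> //; apply: bicommutant_trans Lp.
  exact: bicommutant_horner.
have [P PE] := boolp.choice lift.
pose c r' := \sum_(k <- r') k *: P k.
have diag r' : {subset r' <= r} -> bicommutant a (c r') /\
    exists2 s, diagonalizes s (c r') & forall j, j \in s -> bicommutant a j.2.
  elim: r' => [_|k r' IHr' sub].
    rewrite /c big_nil; split; first by move=> w _; exact: commr0.
    exists [:: (0, 1)]; last first.
      by move=> j; rewrite inE => /eqP-> /=; exact: bicommutant1.
    split=> [|j]; first by rewrite big_seq1.
    by rewrite inE => /eqP->; rewrite mul0r mulr0 scale0r.
  have [|bc [s sc bs]] := IHr'.
    by move=> z zr'; rewrite sub // inE zr' orbT.
  have [pp bp _] := PE k (sub k (mem_head _ _)).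
  have -> : c (k :: r') = c r' + k *: P k by rewrite /c big_cons addrC.
  split; first by apply: bicommutantD => //; exact: bicommutantZ.
  exists ([seq (j.1 + k, j.2 * P k) | j <- s] ++
          [seq (j.1, j.2 * (1 - P k)) | j <- s]).
    apply: diagonalizesD => //; first exact: bicommutant_comm2 bp bc.
    by move=> j js; exact: bicommutant_comm2 bp (bs j js).
  move=> j; rewrite mem_cat => /orP[] /mapP[l ls ->] /=.
    by apply: bicommutantM => //; exact: bs.
  apply: bicommutantM; first exact: bs.
  by apply: bicommutantB => //; exact: bicommutant1.
have [bc [s sc bs]] := diag r (fun _ h => h).
exists (c r), s; split=> //.
pose d := horner_alg a ('X - \sum_(k <- r) k *: L k).
have -> : a - c r = d + \sum_(k <- r) k *: (horner_alg a (L k) - P k).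
  rewrite /d rmorphB /= horner_algX rmorph_sum /=.
  under [X in _ = a - X + _]eq_bigr do rewrite horner_algZ.
  rewrite -addrA; congr (_ + _); rewrite [RHS]addrC -sumrB -sumrN.
  by apply: eq_bigr => k _; rewrite scalerBr addrC addKr.
have bd k : k \in r -> bicommutant a (horner_alg a (L k) - P k).
  move=> kr; have [_ bp _] := PE k kr.
  by apply: bicommutantB => //; exact: bicommutant_horner.
have td : top_nilpotent d.
  apply: (top_nilpotent_horner rN ar) => z zr.
  rewrite hornerD hornerN hornerX horner_sum (bigD1_seq z) //= hornerZ LE //.
  rewrite eqxx mulr1 big1_seq ?addr0 ?subrr // => k /andP[kz kr].
  by rewrite hornerZ LE // eq_sym (negPf kz) mulr0.
apply: top_nilpotentD => //; last first.
  apply: (@top_nilpotent_sum a) => k kr; first by apply/bicommutantZ/bd.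
  by apply: top_nilpotentZ; have [] := PE k kr.
apply: (@bicommutant_comm2 _ _ a); first exact: bicommutant_horner.
by rewrite big_seq; apply: bicommutant_sum => k /bd; exact: bicommutantZ.
Qed.

End Diagonal.

(** * The socle *)

Section Socle.
Context {R : realType} {A : algType R[i]}.
Implicit Types (a u x y : A) (g : {poly R[i]}).

Lemma socle0 : socle (0 : A).
Proof. by exists [::]; split=> //; rewrite big_nil. Qed.

Lemma socleD x y : socle x -> socle y -> socle (x + y).
Proof.
move=> [s [s1 ->]] [t [t1 ->]]; exists (s ++ t); rewrite big_cat; split=> // u.
by rewrite mem_cat => /orP[/s1|/t1].
Qed.

Lemma socle_sum I (r : seq I) (P : pred I) (F : I -> A) :
  (forall i, P i -> socle (F i)) -> socle (\sum_(i <- r | P i) F i).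
Proof. by move=> sF; elim/big_ind: _ => //; [exact: socle0|exact: socleD]. Qed.

(** The product [u * y] is of rank one or zero. *)
Lemma socleMr x y : socle x -> socle (x * y).
Proof.
move=> [s [s1 ->]]; rewrite mulr_suml big_seq; apply: socle_sum => u /s1[_ uA].
have [->|uy0] := eqVneq (u * y) 0; first exact: socle0.
exists [:: u * y]; split; last by rewrite big_seq1.
move=> w; rewrite inE => /eqP ->; split=> [|x']; first exact/eqP.
have [z uz] := uA (y * x'); exists z.
by rewrite scalerAl -uz !mulrA.
Qed.

Lemma socleB x y : socle x -> socle y -> socle (x - y).
Proof.
by move=> sx sy; apply: socleD => //; rewrite -mulrN1; apply: socleMr.
Qed.

Definition algebraic x : Prop := exists2 g, g != 0 & horner_alg x g = 0.

(** The difference quotient of [g] at two elements that do not commute: the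
    polynomials [drop_poly i.+1 g] are its coefficients in powers of [x]. *)
Lemma horner_alg_sub x u g : horner_alg (x + u) g - horner_alg x g =
  \sum_(i < size g) x ^+ i * u * horner_alg (x + u) (drop_poly i.+1 g).
Proof.
set y := x + u.
have step (z : A) (f : {poly R[i]}) :
    horner_alg z f = (f`_0)%:A + z * horner_alg z (drop_poly 1 f).
  rewrite -{1}(poly_take_drop 1 f) rmorphD mulrC rmorphM /= horner_algX.
  congr (_ + _); rewrite -(horner_algC z); congr (horner_alg z _).
  by apply/polyP => -[|j]; rewrite coef_take_poly coefC.
suff : forall N, (size g <= N)%N -> horner_alg y g - horner_alg x g =
    \sum_(i < N) x ^+ i * u * horner_alg y (drop_poly i.+1 g) by apply.
move=> N; elim: N g => [g|N IHN g gN].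
  by rewrite size_poly_leq0 => /eqP->; rewrite !rmorph0 subr0 big_ord0.
rewrite (step y) (step x) opprD addrACA subrr add0r {1}/y mulrDl.
rewrite addrAC -mulrBr IHN ?size_drop_poly ?leq_subLR ?add1n //.
rewrite big_ord_recl expr0 mul1r addrC mulr_sumr; congr (_ + _).
apply: eq_bigr => i _; rewrite !mulrA -exprS /= /bump leq0n add1n.
congr (_ * horner_alg y _); apply/polyP => j.
by rewrite !coef_drop_poly -addnA addn1.
Qed.

(** Let [y = x + u] and [g(x) = 0]. Then [g(y)] is the sum of the
    [x^i u q_i(y)], and the rank one property [u x^i u = k_i u] gives
    [u g(y) = u r(y)] with [r = \sum_i k_i q_i] of smaller degree than [g]. So
    [u] is annihilated by [(g - r)(y)], and [y] by [g (g - r)]. *)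
Lemma algebraicD_rank_one x u : algebraic x -> rank_one u -> algebraic (x + u).
Proof.
move=> [g g0 gx] [_ uA]; set y := x + u.
have /boolp.choice[k kE] : forall i, exists k : R[i], u * x ^+ i * u = k *: u.
  by move=> i; exact: uA.
have gyE : horner_alg y g =
    \sum_(i < size g) x ^+ i * u * horner_alg y (drop_poly i.+1 g).
  by rewrite -horner_alg_sub gx subr0.
pose r := \sum_(i < size g) k i *: drop_poly i.+1 g.
have ur : u * horner_alg y (g - r) = 0.
  rewrite rmorphB /= mulrBr gyE mulr_sumr /r rmorph_sum mulr_sumr -sumrB.
  rewrite big1 // => i _ /=.
  by rewrite horner_algZ !mulrA kE -scalerAl -scalerAr subrr.
exists (g * (g - r)).
  rewrite mulf_neq0 // subr_eq0; apply/eqP => gr.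
  have : (size g < size g)%N; last by rewrite ltnn.
  rewrite {1}gr (leq_ltn_trans (size_sum _ _ _)) //.
  have sg : (0 < size g)%N by rewrite size_poly_gt0.
  rewrite -(ltn_predK sg) ltnS; apply/bigmax_leqP => i _.
  rewrite (leq_trans (size_scale_leq _ _)) // size_drop_poly.
  by rewrite -[leqRHS]subn1 leq_sub2l.
rewrite rmorphM /= gyE mulr_suml big1 // => i _.
rewrite -[LHS]mulrA.
have -> : horner_alg y (drop_poly i.+1 g) * horner_alg y (g - r) =
    horner_alg y (g - r) * horner_alg y (drop_poly i.+1 g).
  by rewrite -!rmorphM mulrC.
by rewrite mulrA -(mulrA _ u) ur mulr0 mul0r.
Qed.

Lemma socle_algebraic x : socle x -> algebraic x.
Proof.
move=> [s [s1 ->]]; elim: s s1 => [_|u s IHs s1].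
  by rewrite big_nil; exists 'X; rewrite ?polyX_eq0 // horner_algX.
rewrite big_cons addrC; apply: algebraicD_rank_one.
  by apply: IHs => w ws; apply: s1; rewrite inE ws orbT.
by apply: s1; rewrite mem_head.
Qed.

Lemma algebraic_spectrum x : algebraic x -> finite_set (spectrum x).
Proof.
move=> [g g0 gx]; have [r gE] := closed_field_poly_normal g.
apply: (sub_finite_set _ (finite_seq r)) => z /= zx; apply: contrapT => zr.
apply: zx; have : ~~ root g z.
  by rewrite gE rootZ ?lead_coef_eq0 // root_prod_XsubC; apply/negP.
rewrite rootE => gz.
have /factor_theorem[q gq] : root (g - (g.[z])%:P) z.
  by rewrite rootE hornerD hornerN hornerC subrr.
have E : horner_alg x q * (x - z%:A) = - (g.[z])%:A.
  have := congr1 (horner_alg x) gq.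
  by rewrite !rmorphB rmorphM rmorphB /= gx !horner_algC horner_algX sub0r.
have cq : GRing.comm (x - z%:A) (horner_alg x q).
  apply/commr_sym/commrB.
    exact/commr_sym/bicommutant_comm/bicommutant_horner.
  by rewrite /GRing.comm mulr_algr mulr_algl.
exists (- (g.[z])^-1 *: horner_alg x q); split.
  rewrite -scalerAr cq E scaleNr scalerN opprK scalerA mulVf // scale1r //.
by rewrite -scalerAl E scaleNr scalerN opprK scalerA mulVf // scale1r.
Qed.

(** Write [g = X^m h] with [h(0) <> 0]; then [h(x)] is invertible. *)
Lemma algebraic_nilpotent x : algebraic x -> quasinilpotent x -> nilpotent x.
Proof.
move=> [g g0 gx] qx; have [m [h]] := multiplicity_XsubC g 0.
rewrite g0 /= subr0 => h0 gE.
have [|w|h' [hh' _]] := @horner_alg_invertible _ _ x h.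
- by apply: contraNneq h0 => ->; rewrite root0.
- move=> hw; apply: contrapT => nw; have : spectrum x w by [].
  by rewrite qx /= => w0; move: hw; rewrite w0 (negPf h0).
exists m; have := gx; rewrite gE mulrC rmorphM rmorphXn /= horner_algX.
by move=> /(congr1 (fun z => z * h')); rewrite -mulrA hh' mulr1 mul0r.
Qed.

End Socle.

(** * Quasinilpotent equivalence and common diagonal parts *)

Section CommonDiagonalPart.
Context {R : realType} {A : banachAlgType R[i]}.
Implicit Types (a b c p : A) (s : seq (R[i] * A)).

Lemma rho_null_of_comm a c :
  GRing.comm c a -> top_nilpotent (a - c) -> rho_null a c /\ rho_null c a.
Proof.
move=> ca fac; split; first exact/(rho_null_comm (commr_sym ca)).
by apply/(rho_null_comm ca); rewrite -opprB; exact: top_nilpotentN.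
Qed.

Lemma dist_spec_eq0_of_common a b c : GRing.comm c a -> GRing.comm c b ->
  top_nilpotent (a - c) -> top_nilpotent (b - c) -> dist_spec a b = 0%E.
Proof.
move=> ca cb fa fb; have [ac c_a] := rho_null_of_comm ca fa.
have [bc c_b] := rho_null_of_comm cb fb.
apply/dist_spec_eq0; split; first exact: rho_null_trans ac c_b.
exact: rho_null_trans bc c_a.
Qed.

(** By transitivity [d(c, b) = 0]; being diagonal, [c] then commutes with [b],
    so that [d(c, b) = 0] says that [b - c] is topologically nilpotent. *)
Lemma common_diagonal_part a b c s :
  bicommutant a c -> top_nilpotent (a - c) -> diagonalizes s c ->
  dist_spec a b = 0%E -> GRing.comm c b /\ top_nilpotent (b - c).
Proof.
move=> bc fa sc /dist_spec_eq0[ab ba].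
have [ac ca] := rho_null_of_comm (commr_sym (bicommutant_comm bc)) fa.
have c_b := rho_null_trans ca ab; have b_c := rho_null_trans ba ac.
have cb : GRing.comm c b by apply: diagonal_comm sc (rho_null_inner c_b b_c).
by split=> //; apply/(rho_null_comm (commr_sym cb)).
Qed.

(** If [k <> 0] then [a p = (k + (a - c)) p] with [k + (a - c)] invertible, so
    that [p] is a right multiple of [a]. *)
Lemma spectral_projection_multiple a c p (k : R[i]) : k != 0 ->
  bicommutant a c -> top_nilpotent (a - c) -> bicommutant a p ->
  c * p = k *: p -> exists x, p = a * x.
Proof.
move=> k0 bc fa bp cp.
have [|x [ax xa]] := @invertible_1B_top_nilpotent R A (- (k^-1 *: (a - c))).
  exact/top_nilpotentN/top_nilpotentZ.
exists (k^-1 *: (p * x)).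
have ap : a * p = k *: (p * (1 - - (k^-1 *: (a - c)))).
  rewrite opprK mulrDr mulr1 scalerDr -scalerAr scalerA mulfV // scale1r.
  by rewrite mulrBr -cp !(bicommutant_comm2 bp) //; first by rewrite subrKC.
rewrite -scalerAr mulrA ap -scalerAl -mulrA ax mulr1 scalerA.
by rewrite mulVf // scale1r.
Qed.

Lemma socle_diagonal_part a c s : socle a ->
  bicommutant a c -> top_nilpotent (a - c) -> diagonalizes s c ->
  (forall j, j \in s -> bicommutant a j.2) -> socle c.
Proof.
move=> sa bc fa [s1 sc] bs.
rewrite -[c]mulr1 -s1 mulr_sumr big_seq; apply: socle_sum => j js.
have [cj _] := sc j js; rewrite cj; have [->|k0] := eqVneq j.1 0.
  by rewrite scale0r; exact: socle0.
have [x ->] := spectral_projection_multiple k0 bc fa (bs j js) cj.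
by rewrite scalerAr; exact: socleMr.
Qed.

Lemma nilpotent_top_nilpotent a : nilpotent a -> top_nilpotent a.
Proof.
move=> [n an]; apply: top_nilpotentP => e e0; exists n.+1 => //.
by rewrite exprS an mulr0 rnorm0 exprn_ge0 // ltW.
Qed.

Lemma socle_nilpotent a : socle a -> top_nilpotent a -> nilpotent a.
Proof.
by move=> /socle_algebraic ? /quasinilpotentP; exact: algebraic_nilpotent.
Qed.

End CommonDiagonalPart.

Theorem corollary4p4 (R : realType) (A : banachAlgType R[i]) :
  (forall a b : A, finite_set (spectrum a) ->
     (dist_spec a b = 0%E <->
      exists c : A, [/\ GRing.comm c a, GRing.comm c b,
        quasinilpotent (a - c) & quasinilpotent (b - c)]))
  /\
  (semisimple A -> forall a b : A, socle a -> socle b ->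
     (dist_spec a b = 0%E <->
      exists c : A, [/\ socle c, GRing.comm c a, GRing.comm c b,
        nilpotent (a - c) & nilpotent (b - c)])).
Proof.
split=> [a b fin_a|_ a b sa sb].
  split=> [ab0|[c [ca cb /quasinilpotentP fa /quasinilpotentP fb]]].
    have [c [s [bc fa sc _]]] := diagonal_part fin_a.
    have [cb fb] := common_diagonal_part bc fa sc ab0.
    exists c; split=> //; [|exact/quasinilpotentP|exact/quasinilpotentP].
    exact/commr_sym/bicommutant_comm.
  exact: dist_spec_eq0_of_common ca cb fa fb.
split=> [ab0|[c [_ ca cb /nilpotent_top_nilpotent fa]]]; last first.
  move=> /nilpotent_top_nilpotent fb.
  exact: dist_spec_eq0_of_common ca cb fa fb.
have fin_a := algebraic_spectrum (socle_algebraic sa).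
have [c [s [bc fa sc bs]]] := diagonal_part fin_a.
have [cb fb] := common_diagonal_part bc fa sc ab0.
have socc := socle_diagonal_part sa bc fa sc bs.
exists c; split=> //.
- exact/commr_sym/bicommutant_comm.
- by apply: socle_nilpotent fa; exact: socleB.
- by apply: socle_nilpotent fb; exact: socleB.
Qed.
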